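(* Let $n\ge4$ and let $\mathbf{X}=(X_1,\dots,X_n)\in(\mathbb{P}^1)^n$ be in linear general position. Then the singular locus of the resectioning variety $\mathcal{R}_{\mathbf{X}}^{1,1}\subseteq(\mathbb{P}^1)^n$ is $$\left(\mathcal{R}_{\mathbf{X}}^{1,1}\right)_{\mathrm{sing}}=\mathcal{V}_{n,1}^1.$$
   Context: Work over $\mathbb{C}$. Points $\mathbf{X}=(X_1,\dots,X_n)\in(\mathbb{P}^N)^n$ are in linear general position if no $N+1$ of them lie in a common hyperplane (for $N=1$: the points are pairwise distinct). The resectioning variety $\mathcal{R}_{\mathbf{X}}^{N,h}$ is the Zariski closure of the image of the rational map $\mathbb{P}(\mathbb{C}^{(h+1)\times(N+1)})\dashrightarrow(\mathbb{P}^h)^n$, $C\mapsto(CX_1,\dots,CX_n)$. Further, $\mathcal{V}_{n,r}^h=\{(x_1,\dots,x_n)\in(\mathbb{P}^h)^n:\mathrm{rank}[x_1\ \cdots\ x_n]=r\}$; thus $\mathcal{V}_{n,1}^1$ is the image of $\mathbb{P}^1$ under the $n$-fold diagonal embedding. *)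

(* Defs.v *)
From HB Require Import structures.
From mathcomp Require Import all_boot all_order all_algebra.
From mathcomp Require Import boolp classical_sets reals.
From mathcomp Require Import mpoly complex.

Set Implicit Arguments.
Unset Strict Implicit.
Unset Printing Implicit Defensive.

Import GRing.Theory.
Local Open Scope ring_scope.
Local Open Scope classical_set_scope.

(* A point of (P^h)^n is represented by any matrix x = [x_1 ... x_n] of
   homogeneous coordinates, that is, any (h+1) x n matrix with nonzero columns,
   defined up to rescaling each column.  A subset of (P^h)^n is encoded as the
   set of all matrices representing its points; such a set is invariant under
   nonzero rescalings of the columns. *)
Definition multiproj (K : fieldType) (h n : nat) : set 'M[K]_(h.+1, n) :=
  [set x | forall j, col j x != 0].

Definition general_position (K : fieldType) (N n : nat)
    (X : 'M[K]_(N.+1, n)) : Prop :=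
  ~ exists (s : 'I_N.+1 -> 'I_n) (H : 'rV[K]_N.+1),
      [/\ injective s, H != 0 & forall k, H *m col (s k) X = 0].

(* The variable of index [mxvec_index i j] is the i-th coordinate of x_j. *)
Definition mxeval (K : fieldType) (m n : nat) (f : {mpoly K[m * n]})
    (x : 'M[K]_(m, n)) : K :=
  f.@[fun k => mxvec x 0 k].

Definition multihomog (K : fieldType) (m n : nat)
    (f : {mpoly K[m * n]}) : Prop :=
  exists e : 'I_n -> nat, forall u, u \in msupp f ->
    forall j, (\sum_(i < m) u (mxvec_index i j))%N = e j.

Definition zariski_closed (K : fieldType) (h n : nat)
    (Z : set 'M[K]_(h.+1, n)) : Prop :=
  exists F : set {mpoly K[h.+1 * n]}, F `<=` [set f | multihomog f] /\
    Z = [set x | multiproj x /\ forall f, F f -> mxeval f x = 0].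

Definition zariski_closure (K : fieldType) (h n : nat)
    (S : set 'M[K]_(h.+1, n)) : set 'M[K]_(h.+1, n) :=
  smallest (@zariski_closed K h n) S.

Definition irreducible_closed (K : fieldType) (h n : nat)
    (Z : set 'M[K]_(h.+1, n)) : Prop :=
  [/\ zariski_closed Z, Z !=set0 &
    forall A B, zariski_closed A -> zariski_closed B ->
      Z `<=` A `|` B -> Z `<=` A \/ Z `<=` B].

(* A chain Z_0 < ... < Z_d of irreducible closed subsets of S through x;
   these correspond to the chains of primes of the local ring O_{S,x}. *)
Definition irreducible_chain (K : fieldType) (h n : nat)
    (S : set 'M[K]_(h.+1, n)) (x : 'M[K]_(h.+1, n)) (d : nat)
    (Z : nat -> set 'M[K]_(h.+1, n)) : Prop :=
  (forall i, (i <= d)%N -> [/\ irreducible_closed (Z i), Z i `<=` S & Z i x]) /\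
  (forall i, (i < d)%N -> Z i `<` Z i.+1).

(* d = dim_x S, the Krull dimension of O_{S,x} *)
Definition local_dim (K : fieldType) (h n : nat)
    (S : set 'M[K]_(h.+1, n)) (x : 'M[K]_(h.+1, n)) (d : nat) : Prop :=
  (exists Z, irreducible_chain S x d Z) /\
  (forall e Z, irreducible_chain S x e Z -> (e <= d)%N).

(* T is the tangent space at x of the multicone over S in the space of
   matrices: the common kernel of the differentials at x of the multihomogeneous
   polynomials vanishing on S. *)
Definition cone_tangent_space (K : fieldType) (h n : nat)
    (S : set 'M[K]_(h.+1, n)) (x : 'M[K]_(h.+1, n))
    (T : {vspace 'M[K]_(h.+1, n)}) : Prop :=
  forall v, v \in T <->
    forall f, multihomog f -> (forall y, S y -> mxeval f y = 0) ->
      \sum_(k < h.+1 * n) mxeval f^`M(k) x * mxvec v 0 k = 0.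

(* The Zariski tangent space of S at x is the quotient of the tangent space T of
   the multicone by the n-dimensional tangent space of the orbit of x under
   column rescalings, so its dimension is dim T - n.  The point x is singular
   when this exceeds dim_x S, i.e. when O_{S,x} is not regular. *)
Definition singular_locus (K : fieldType) (h n : nat)
    (S : set 'M[K]_(h.+1, n)) : set 'M[K]_(h.+1, n) :=
  [set x | S x /\ exists d T,
     [/\ local_dim S x d, cone_tangent_space S x T & (d + n < \dim T)%N]].

(* The image of C |-> (C X_1, ..., C X_n), defined where every C X_j != 0;
   the diagonal factor ranges over the representatives of each image point. *)
Definition resectioning_image (K : fieldType) (N h n : nat)
    (X : 'M[K]_(N.+1, n)) : set 'M[K]_(h.+1, n) :=
  [set x | multiproj x /\ exists (C : 'M[K]_(h.+1, N.+1)) (a : 'rV[K]_n),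
     multiproj (C *m X) /\ x = C *m X *m diag_mx a].

Definition resectioning_variety (K : fieldType) (N h n : nat)
    (X : 'M[K]_(N.+1, n)) : set 'M[K]_(h.+1, n) :=
  zariski_closure (@resectioning_image K N h n X).

Definition rank_locus (K : fieldType) (h n r : nat) : set 'M[K]_(h.+1, n) :=
  [set x | multiproj x /\ \rank x = r].

Arguments resectioning_image {K N} h {n} X _.
Arguments resectioning_variety {K N} h {n} X _.
Arguments rank_locus {K} h n r _.

(* Main.v *)
From HB Require Import structures.
Require Import Defs.
From mathcomp Require Import all_boot all_order all_algebra.
From mathcomp Require Import boolp classical_sets reals.
From mathcomp Require Import mpoly complex.
From mathcomp Require Import ring zify.

(** Write [ab] for the 2 x 2 minor of the columns a and b, and S for the
variety.  On the image of C |-> CX all minors are rescaled by det C, so the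
cross-ratios of the columns agree with those of X.  Cleared of denominators
this gives, for all i, k, l, j, the equation
  [il]_X [kj]_X [ik]_x [lj]_x = [ik]_X [lj]_X [il]_x [kj]_x
on S (cross_vanishes).

Off the diagonal.  If x has rank 2, there are distinct i, k, j such that
column j is independent from columns i and k; columns i and k may be parallel.
The equation for l then determines column l, up to a scalar, as an explicit
polynomial in columns i, k, j.  This polynomial map, called chart below, has
two uses.
- Up to column scalings its values are of the form CX whenever the three columns
  are pairwise independent, hence they lie in S whenever they are points at all
  (chart_variety).  Freeing the columns i, k, j one after the other gives a
  chain of length 3 of irreducible closed subsets through x
  (offdiagonal_chain), so dim_x S >= 3.
- The differential at x of the equation for l restricts column l of a tangent
  vector to a line as soon as columns i, k, j of that vector vanish.  Hence the
  tangent space of the multicone has dimension at most 6 + (n - 3) = n + 3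
  (offdiagonal_tangent), and x is smooth.

On the diagonal.  The variety S contains all points (p, .., p, q, p, .., p),
because chart is defined for y_i = y_k = p and y_j = q and takes this value
(one_off_variety).  At a diagonal point these n curves span all tangent
directions, so the tangent space of the multicone has the full dimension 2n
(diagonal_differential).  On the other hand dim_x S <= 3 (chain_le3), and
3 + n < 2n exactly when n >= 4.

The bound dim_x S <= 3 is obtained by counting.  A chain of length d of
irreducible closed sets yields, for a fixed E and every T, at least
binomial(T + d, d) multihomogeneous polynomials of multidegree (TE, .., TE)
that are linearly independent on its largest member (chain_independent).
Pulling polynomials on S back along C |-> CX embeds them in the forms of degree
nTE in the four entries of C, a space whose dimension is cubic in T
(independent_resectioning).

Irreducibility and membership in closures are tested on polynomial curves
only, where everything reduces to the fact that a nonzero polynomial in one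
variable over an infinite field has a nonroot. *)

Section ResectioningVariety.

Set Implicit Arguments.
Unset Strict Implicit.
Unset Printing Implicit Defensive.
Import Order.TTheory GRing.Theory Num.Theory.
Local Open Scope ring_scope.
Local Open Scope classical_set_scope.

(** * Multihomogeneous polynomials of a given multidegree *)

Definition mhomog (K : fieldType) (m n : nat) (e : 'I_n -> nat)
    (f : {mpoly K[m * n]}) : Prop :=
  forall u, u \in msupp f ->
    forall j, (\sum_(i < m) u (mxvec_index i j))%N = e j.

Lemma mhomog_multihomog (K : fieldType) (m n : nat) (e : 'I_n -> nat)
    (f : {mpoly K[m * n]}) : mhomog e f -> multihomog f.
Proof. by exists e. Qed.

Lemma mhomogD (K : fieldType) (m n : nat) (e : 'I_n -> nat)
    (f g : {mpoly K[m * n]}) :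
  mhomog e f -> mhomog e g -> mhomog e (f + g).
Proof.
move=> hf hg u /msuppD_le; rewrite mem_cat => /orP[]; [exact: hf|exact: hg].
Qed.

Lemma mhomogZ (K : fieldType) (m n : nat) (e : 'I_n -> nat) (c : K)
    (f : {mpoly K[m * n]}) : mhomog e f -> mhomog e (c *: f).
Proof. by move=> hf u /msuppZ_le; apply: hf. Qed.

Lemma mhomog_sum (K : fieldType) (m n : nat) (e : 'I_n -> nat)
    (I : Type) (r : seq I) (F : I -> {mpoly K[m * n]}) :
  (forall i, mhomog e (F i)) -> mhomog e (\sum_(i <- r) F i).
Proof.
move=> hF; elim/big_rec: _ => [u|i f _ hf]; first by rewrite msupp0.
by apply: mhomogD.
Qed.

Lemma mhomogM (K : fieldType) (m n : nat) (e e' : 'I_n -> nat)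
    (f g : {mpoly K[m * n]}) :
  mhomog e f -> mhomog e' g ->
  mhomog (fun j => e j + e' j)%N (f * g).
Proof.
move=> hf hg u /msuppM_le /allpairsP[[u1 u2] /= [h1 h2 ->]] j.
rewrite -(hf _ h1) -(hg _ h2) -big_split /=.
by apply: eq_bigr => i _; rewrite mnmDE.
Qed.

Lemma mhomog1 (K : fieldType) (m n : nat) :
  @mhomog K m n (fun=> 0%N) 1.
Proof.
move=> u; rewrite -mpolyC1 msupp1 inE => /eqP-> j.
by rewrite big1 // => i _; rewrite mnm0E.
Qed.

Lemma mhomogX (K : fieldType) (m n : nat) (i : 'I_m) (j : 'I_n) :
  @mhomog K m n (fun l => l == j) 'X_(mxvec_index i j).
Proof.
move=> u; rewrite msuppX inE => /eqP-> l.
have E k : (mxvec_index i j == mxvec_index k l) = (i == k) && (j == l).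
  by rewrite (inj_eq (@cast_ord_inj _ _ _) (enum_rank (i, j)))
     (inj_eq enum_rank_inj) xpair_eqE.
rewrite (bigD1 i) //= mnm1E E eqxx /= big1 ?addn0 1?eq_sym // => k ki.
by rewrite mnm1E E eq_sym (negbTE ki).
Qed.

Lemma mhomog_dhomog (K : fieldType) (m n : nat) (e : 'I_n -> nat)
    (f : {mpoly K[m * n]}) :
  mhomog e f -> f \is (\sum_j e j)%N.-homog.
Proof.
move=> hf; apply/dhomogP => u /hf hu; rewrite /= mdegE.
rewrite (reindex _ (curry_mxvec_bij _ _)) /=.
rewrite (eq_bigr (fun ij => u (mxvec_index ij.1 ij.2))); last by case.
rewrite -(pair_bigA _ (fun i j => u (mxvec_index i j))) exchange_big /=.
by apply: eq_bigr => j _.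
Qed.

Section MxEval.
Variables (K : fieldType) (m n : nat).
Implicit Types (f g : {mpoly K[m * n]}) (x : 'M[K]_(m, n)).

Lemma mxevalD f g x : mxeval (f + g) x = mxeval f x + mxeval g x.
Proof. exact: mevalD. Qed.
Lemma mxevalM f g x : mxeval (f * g) x = mxeval f x * mxeval g x.
Proof. exact: mevalM. Qed.
Lemma mxevalZ c f x : mxeval (c *: f) x = c * mxeval f x.
Proof. exact: mevalZ. Qed.
Lemma mxevalX i j x : mxeval 'X_(mxvec_index i j) x = x i j.
Proof. by rewrite /mxeval mevalXU mxvecE. Qed.
Lemma mxeval_sum (I : Type) (r : seq I) (F : I -> {mpoly K[m * n]}) x :
  mxeval (\sum_(i <- r) F i) x = \sum_(i <- r) mxeval (F i) x.
Proof. exact: raddf_sum. Qed.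

(** This is why the zero sets of multihomogeneous polynomials are well defined
on points of (P^h)^n rather than on their representatives. *)
Lemma mxeval_scale e f x (a : 'rV[K]_n) : mhomog e f ->
  mxeval f (x *m diag_mx a) = (\prod_j a 0 j ^+ e j) * mxeval f x.
Proof.
move=> hf; rewrite /mxeval !mevalE big_distrr /=.
rewrite [LHS]big_seq [RHS]big_seq; apply: eq_bigr => u /hf hu.
rewrite mulrCA; congr (_ * _).
rewrite 2!(reindex _ (curry_mxvec_bij _ _)) /=.
rewrite (eq_bigr (fun ij => a 0 ij.2 ^+ u (mxvec_index ij.1 ij.2) *
  mxvec x 0 (uncurry (@mxvec_index m n) ij)
    ^+ u (uncurry (@mxvec_index m n) ij))); last first.
  case=> i j _ /=.
  rewrite !mxvecE mul_mx_diag mxE exprMn_comm; last exact: mulrC.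
  by rewrite mulrC.
rewrite big_split /=; congr (_ * _).
rewrite -(pair_bigA _ (fun i j => a 0 j ^+ u (mxvec_index i j))).
rewrite exchange_big /=.
by apply: eq_bigr => j _; rewrite -hu expr_sum.
Qed.
End MxEval.

(** * Closure, and polynomial curves *)

(** A set S containing a matrix with a zero column lies in no closed set, and the
intersection defining its closure is then the whole space of matrices; hence
the hypothesis on S. *)
Lemma zariski_closureE (K : fieldType) (h n : nat) (S : set 'M[K]_(h.+1, n)) :
  S `<=` @multiproj K h n ->
  zariski_closure S = [set x | multiproj x /\ forall f, multihomog f ->
    (forall y, S y -> mxeval f y = 0) -> mxeval f x = 0].
Proof.
move=> hS; apply/seteqP; split=> x.
  apply; split.
    exists [set f | multihomog f /\ forall y, S y -> mxeval f y = 0].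
    split=> [f []//|]; apply/seteqP.
    by split=> y [hy H]; split=> // f; [case; apply: H|move=> *; apply: H].
  by move=> y Sy; split; [exact: hS|move=> f _; apply].
move=> [hx H] Z [[F [hF ->]] hZ]; split=> // f Ff.
by apply: H => [|y /hZ [_]]; [exact: hF|apply].
Qed.

Lemma zariski_closure_closed (K : fieldType) (h n : nat)
    (S : set 'M[K]_(h.+1, n)) :
  S `<=` @multiproj K h n -> zariski_closed (zariski_closure S).
Proof.
move=> hS; rewrite zariski_closureE //.
exists [set f | multihomog f /\ forall y, S y -> mxeval f y = 0].
split=> [f []//|]; apply/seteqP.
by split=> y [hy H]; split=> // f; [case; apply: H|move=> *; apply: H].
Qed.

Lemma sub_zariski_closure (K : fieldType) (h n : nat)
    (S : set 'M[K]_(h.+1, n)) : S `<=` zariski_closure S.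
Proof. exact: sub_gen_smallest. Qed.

Lemma zariski_closure_min (K : fieldType) (h n : nat)
    (S Z : set 'M[K]_(h.+1, n)) :
  zariski_closed Z -> S `<=` Z -> zariski_closure S `<=` Z.
Proof. exact: smallest_sub. Qed.

Lemma closed_zeros (K : fieldType) (h n : nat) (f : {mpoly K[h.+1 * n]}) :
  multihomog f -> zariski_closed [set x | multiproj x /\ mxeval f x = 0].
Proof.
move=> hf; exists [set f]; split=> [_ ->//|]; apply/seteqP.
split=> x [hx H]; split=> //; first by move=> _ ->.
exact: H.
Qed.

(** The homogeneous ideal of an irreducible closed set is prime. *)
Lemma irreducible_mul (K : fieldType) (h n : nat) (Z : set 'M[K]_(h.+1, n))
    (f g : {mpoly K[h.+1 * n]}) :
  irreducible_closed Z -> multihomog f -> multihomog g ->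
  (forall x, Z x -> mxeval f x * mxeval g x = 0) ->
  (forall x, Z x -> mxeval f x = 0) \/ (forall x, Z x -> mxeval g x = 0).
Proof.
move=> [[F [_ ZE]] _ irr] hf hg H.
have pZ x : Z x -> multiproj x by rewrite ZE => -[].
case: (irr _ _ (closed_zeros hf) (closed_zeros hg)).
- move=> x Zx; have /eqP := H x Zx; rewrite mulf_eq0.
  by case/orP => /eqP E; [left|right]; split=> //; exact: pZ.
- by move=> sZ; left => x /sZ [].
- by move=> sZ; right => x /sZ [].
Qed.

(** Functions, not polynomials, are the basic objects here: curves are then
built by evaluating the same matrix expressions at moving points, with no
change of the base ring. *)
Definition polyfun (K : nzRingType) (g : K -> K) : Prop :=
  exists p : {poly K}, forall s, g s = p.[s].

Section Polyfun.
Variable K : comNzRingType.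
Implicit Types g : K -> K.

Lemma polyfun_cst c : polyfun (fun=> c : K).
Proof. by exists c%:P => s; rewrite hornerC. Qed.
Lemma polyfunD g1 g2 :
  polyfun g1 -> polyfun g2 -> polyfun (fun s => g1 s + g2 s).
Proof. by move=> [p hp] [q hq]; exists (p + q) => s; rewrite hornerD hp hq. Qed.
Lemma polyfunN g : polyfun g -> polyfun (fun s => - g s).
Proof. by move=> [p hp]; exists (- p) => s; rewrite hornerN hp. Qed.
Lemma polyfunM g1 g2 :
  polyfun g1 -> polyfun g2 -> polyfun (fun s => g1 s * g2 s).
Proof. by move=> [p hp] [q hq]; exists (p * q) => s; rewrite hornerM hp hq. Qed.
Lemma polyfunX g k : polyfun g -> polyfun (fun s => g s ^+ k).
Proof. by move=> [p hp]; exists (p ^+ k) => s; rewrite horner_exp hp. Qed.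
Lemma polyfun_sum (I : Type) (r : seq I) (F : I -> K -> K) :
  (forall i, polyfun (F i)) -> polyfun (fun s => \sum_(i <- r) F i s).
Proof.
move=> /choice[p hp]; exists (\sum_(i <- r) p i) => s.
by rewrite horner_sum; apply: eq_bigr.
Qed.
Lemma polyfun_prod (I : Type) (r : seq I) (F : I -> K -> K) :
  (forall i, polyfun (F i)) -> polyfun (fun s => \prod_(i <- r) F i s).
Proof.
move=> /choice[p hp]; exists (\prod_(i <- r) p i) => s.
by rewrite horner_prod; apply: eq_bigr.
Qed.
End Polyfun.

(** The property holds on a nonempty Zariski open subset of the line; over an
infinite field such properties are consistent with each other. *)
Definition cofinitely (K : fieldType) (P : K -> Prop) : Prop :=
  exists2 p : {poly K}, p != 0 & forall s, p.[s] != 0 -> P s.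

Section Cofinitely.
Variable K : numFieldType.
Implicit Types (P Q : K -> Prop) (g : K -> K).

Lemma cofinitely_ex P : cofinitely P -> exists s, P s.
Proof.
move=> [p p0 hp]; apply/not_existsP => H.
have /(max_poly_roots p0) : all (root p) [seq i%:R | i <- iota 0 (size p)].
  by apply/allP => s _; apply/negPn/negP => /hp; exact: H.
rewrite size_map size_iota ltnn => /(_ _)/notF; apply.
rewrite map_inj_uniq ?iota_uniq // => i j /eqP.
by rewrite eqr_nat => /eqP.
Qed.

Lemma cofinitely_imp P Q :
  (forall s, P s -> Q s) -> cofinitely P -> cofinitely Q.
Proof. by move=> PQ [p p0 hp]; exists p => // s /hp /PQ. Qed.

Lemma cofinitely_and P Q :
  cofinitely P -> cofinitely Q -> cofinitely (fun s => P s /\ Q s).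
Proof.
move=> [p p0 hp] [q q0 hq]; exists (p * q); first exact: mulf_neq0.
by move=> s; rewrite hornerM mulf_eq0 negb_or => /andP[/hp ? /hq].
Qed.

Lemma cofinitely_forall (I : finType) (F : I -> K -> Prop) :
  (forall i, cofinitely (F i)) -> cofinitely (fun s => forall i, F i s).
Proof.
move=> H; have /choice[p hp] : forall i, exists p : {poly K},
    p != 0 /\ forall s, p.[s] != 0 -> F i s.
  by move=> i; case: (H i) => p; exists p.
exists (\prod_i p i); first by apply/prodf_neq0 => i _; case: (hp i).
move=> s; rewrite horner_prod => /prodf_neq0 hs i.
by case: (hp i) => _; apply; exact: hs.
Qed.

Lemma cofinitely_neq0 g s0 :
  polyfun g -> g s0 != 0 -> cofinitely (fun s => g s != 0).
Proof.
move=> [p hp] g0; exists p => [|s]; last by rewrite hp.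
by apply: contra_neq g0 => p0; rewrite hp p0 horner0.
Qed.

Lemma polyfun_cofinitely0 g :
  polyfun g -> cofinitely (fun s => g s = 0) -> forall s, g s = 0.
Proof.
move=> pg g0 s; apply/eqP/negPn/negP => gs.
have [t [-> /eqP//]] :=
  cofinitely_ex (cofinitely_and g0 (cofinitely_neq0 pg gs)).
Qed.

End Cofinitely.

Definition polycurve (K : nzRingType) (m n : nat) (c : K -> 'M[K]_(m, n)) :=
  forall i j, polyfun (fun s => c s i j).

Section Curves.
Variables (K : numFieldType) (h n : nat).
Implicit Types (c : K -> 'M[K]_(h.+1, n)) (Z : set 'M[K]_(h.+1, n)).

Lemma polyfun_mxeval (f : {mpoly K[h.+1 * n]}) c :
  polycurve c -> polyfun (fun s => mxeval f (c s)).
Proof.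
move=> hc.
suff [p hp] : polyfun (fun s => \sum_(u <- msupp f)
    f@_u * \prod_k mxvec (c s) 0 k ^+ u k).
  by exists p => s; rewrite -hp /mxeval mevalE.
apply: polyfun_sum => u; apply: polyfunM; first exact: polyfun_cst.
apply: polyfun_prod => k; apply: polyfunX.
case/mxvec_indexP: k => i j.
by have [q hq] := hc i j; exists q => s; rewrite mxvecE.
Qed.

Lemma cofinitely_multiproj c s0 :
  polycurve c -> multiproj (c s0) -> cofinitely (fun s => multiproj (c s)).
Proof.
move=> hc c0; apply: cofinitely_forall => j.
have /cV0Pn[r] := c0 j; rewrite mxE => cr0.
apply: cofinitely_imp (cofinitely_neq0 (hc r j) cr0) => s cs.
by apply/cV0Pn; exists r; rewrite mxE.
Qed.

(** A polynomial equation that holds at almost all points of a curve holds at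
all of its points: closed sets contain the limits of curves. *)
Lemma closed_curve c Z s0 :
  zariski_closed Z -> polycurve c ->
  cofinitely (fun s => multiproj (c s) -> Z (c s)) ->
  multiproj (c s0) -> Z (c s0).
Proof.
move=> [F [hF ->]] hc hZ c0; split=> // f Ff.
apply: (polyfun_cofinitely0 (polyfun_mxeval f hc)).
apply: cofinitely_imp (cofinitely_and hZ (cofinitely_multiproj hc c0)).
by move=> s [H /H [_]]; exact.
Qed.

(** If neither A nor B contains S, pick y and z in S outside of A and B.  Almost
all points of a curve in S joining y to z avoid A, and almost all avoid B, so
some point of S lies outside of both. *)
Lemma irreducible_closure (S : set 'M[K]_(h.+1, n)) :
  S `<=` @multiproj K h n -> S !=set0 ->
  (forall y z, S y -> S z -> exists c, [/\ polycurve c, c 0 = y, c 1 = z &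
    forall s, multiproj (c s) -> S (c s)]) ->
  irreducible_closed (zariski_closure S).
Proof.
move=> hS [y0 Sy0] link; split; first exact: zariski_closure_closed.
  by exists y0; exact: sub_zariski_closure.
move=> A B cA cB AB; apply/or_asboolP/negPn/negP.
rewrite negb_or => /andP[/asboolPn nA /asboolPn nB].
have pick Z : zariski_closed Z -> ~ zariski_closure S `<=` Z ->
    exists y f, [/\ S y, mxeval f y != 0 & forall x, Z x -> mxeval f x = 0].
  move=> cZ nZ; apply/not_existsP => H; apply: nZ.
  apply: zariski_closure_min => // y Sy; case: cZ H => F [hF ->] H.
  split=> [|f Ff]; first exact: hS.
  apply/eqP/negPn/negP => fy; apply: (H y); exists f; split=> // x [_].
  exact.
have [y [f [Sy fy fA]]] := pick A cA nA.
have [z [g [Sz gz gB]]] := pick B cB nB.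
have [c [hc cy cz cS]] := link y z Sy Sz.
have f0 : mxeval f (c 0) != 0 by rewrite cy.
have g1 : mxeval g (c 1) != 0 by rewrite cz.
have m0 : multiproj (c 0) by rewrite cy; exact: hS.
have [s [[fs gs] ms]] := cofinitely_ex (cofinitely_and
  (cofinitely_and (cofinitely_neq0 (polyfun_mxeval f hc) f0)
     (cofinitely_neq0 (polyfun_mxeval g hc) g1))
  (cofinitely_multiproj hc m0)).
case: (AB (c s)); first by apply: sub_zariski_closure; exact: cS.
  by move=> /fA /eqP; rewrite (negbTE fs).
by move=> /gB /eqP; rewrite (negbTE gs).
Qed.

End Curves.

Section Differential.
Variables (K : numFieldType) (m n : nat).
Implicit Types (f : {mpoly K[m * n]}) (x v : 'M[K]_(m, n)).

Definition differential f x v : K :=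
  \sum_(k < m * n) mxeval f^`M(k) x * mxvec v 0 k.

(** The chain rule along a line, proved by observing that both sides are
derivations at x of the polynomial ring. *)
Lemma differential_line f x v : exists2 p : {poly K},
  (forall s, p.[s] = mxeval f (x + s *: v)) & p^`().[0] = differential f x v.
Proof.
pose P (g : {mpoly K[m * n]}) := exists2 p : {poly K},
  (forall s, p.[s] = mxeval g (x + s *: v)) & p^`().[0] = differential g x v.
have PC c : P c%:MP.
  exists c%:P => [s|]; first by rewrite hornerC /mxeval mevalC.
  rewrite derivC horner0 /differential big1 // => k _.
  by rewrite mderivC /mxeval meval0 mul0r.
have PD f1 f2 : P f1 -> P f2 -> P (f1 + f2).
  move=> [p hp dp] [q hq dq]; exists (p + q) => [s|].
    by rewrite hornerD hp hq mxevalD.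
  rewrite derivD hornerD dp dq -big_split; apply: eq_bigr => k _ /=.
  by rewrite mderivD mxevalD mulrDl.
have PM f1 f2 : P f1 -> P f2 -> P (f1 * f2).
  move=> [p hp dp] [q hq dq]; exists (p * q) => [s|].
    by rewrite hornerM hp hq mxevalM.
  rewrite derivM hornerD !hornerM dp dq hp hq scale0r addr0.
  rewrite mulr_suml mulr_sumr -big_split; apply: eq_bigr => k _ /=.
  by rewrite mderivM mxevalD !mxevalM; ring.
have PX k : P 'X_k.
  exists (((mxvec x 0 k)%:P + (mxvec v 0 k) *: 'X)) => [s|].
    rewrite hornerD hornerC hornerZ hornerX /mxeval mevalXU linearD linearZ /=.
    by rewrite !mxE mulrC.
  rewrite derivD derivC add0r derivZ derivX hornerZ hornerC mulr1.
  rewrite /differential (bigD1 k) //= mderivX mnm1E eqxx scale1r.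
  rewrite (_ : U_(k) - U_(k) = 0)%MM ?mpolyX0; last first.
    by apply/mnmP => l; rewrite mnmBE mnm0E subnn.
  rewrite /mxeval meval1 mul1r big1 ?addr0 // => l lk.
  by rewrite mderivX mnm1E eq_sym (negbTE lk) scale0r meval0 mul0r.
rewrite -/(P f); elim/mpolyind: f => [|c u f _ _ Pf].
  by rewrite -mpolyC0.
apply: PD => //; rewrite -mul_mpolyC; apply: (PM) => //.
rewrite mpolyXE_id; elim/big_rec: _ => [|k g _ Pg]; first exact: PC 1.
apply: (PM) => //; elim: (u k) => [|d IH]; first by rewrite expr0; exact: PC 1.
by rewrite exprS; apply: (PM).
Qed.

Lemma differentialE f x v (p : {poly K}) :
  (forall s, p.[s] = mxeval f (x + s *: v)) -> p^`().[0] = differential f x v.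
Proof.
move=> hp; have [q hq <-] := differential_line f x v.
suff -> : p = q by [].
apply/eqP; rewrite -subr_eq0; apply/negPn/negP => pq0.
have [] : exists s : K, False; last by [].
apply: cofinitely_ex; exists (p - q) => // s.
by rewrite hornerD hornerN hp hq subrr eqxx.
Qed.

End Differential.

(** * Counting multihomogeneous functions bounds the length of chains *)

Lemma mhomog_prod (K : fieldType) (m n : nat) (I : Type) (r : seq I)
    (e : I -> 'I_n -> nat) (F : I -> {mpoly K[m * n]}) :
  (forall i, mhomog (e i) (F i)) ->
  mhomog (fun j => \sum_(i <- r) e i j)%N (\prod_(i <- r) F i).
Proof.
move=> hF; elim: r => [|i r IH] u; rewrite ?big_nil ?big_cons.
  by move=> /mhomog1 hu j; rewrite big_nil hu.
by move=> /(mhomogM (hF i) IH) hu j; rewrite big_cons hu.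
Qed.

Lemma mhomog_exp (K : fieldType) (m n : nat) (e : 'I_n -> nat) (k : nat)
    (f : {mpoly K[m * n]}) :
  mhomog e f -> mhomog (fun j => k * e j)%N (f ^+ k).
Proof.
move=> hf; elim: k => [|k IH] u; first by rewrite expr0 => /mhomog1 hu j.
by rewrite exprS => /(mhomogM hf IH) hu j; rewrite hu mulSn.
Qed.

(** Multiplying by coordinates that do not vanish at z makes all degrees equal,
so that polynomials of different multidegrees can be combined linearly without
losing their nonvanishing at z. *)
Lemma raise_multidegree (K : fieldType) (h n : nat) (e : 'I_n -> nat) (E : nat)
    (f : {mpoly K[h.+1 * n]}) (z : 'M[K]_(h.+1, n)) :
  mhomog e f -> (forall j, e j <= E)%N -> multiproj z -> mxeval f z != 0 ->
  exists g, [/\ mhomog (fun=> E) g, mxeval g z != 0 &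
    forall x, mxeval f x = 0 -> mxeval g x = 0].
Proof.
move=> hf eE hz fz.
have /choice[r hr] : forall j, exists r, z r j != 0.
  by move=> j; have /cV0Pn[r] := hz j; rewrite mxE => zr; exists r.
exists (f * \prod_j 'X_(mxvec_index (r j) j) ^+ (E - e j)); split.
- have hX j := mhomog_exp (k := E - e j) (@mhomogX K _ _ (r j) j).
  move=> u /(mhomogM hf (mhomog_prod hX)) hu j; rewrite hu.
  rewrite (bigD1 j) //= eqxx muln1 big1 ?addn0; first by rewrite subnKC.
  by move=> l lj; rewrite eq_sym (negbTE lj) muln0.
- rewrite mxevalM mulf_neq0 // /mxeval rmorph_prod; apply/prodf_neq0 => j _.
  by rewrite rmorphXn /= expf_neq0 // mevalXU mxvecE.
- by move=> x fx; rewrite mxevalM fx mul0r.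
Qed.

Section Independence.
Variables (K : fieldType) (h n E : nat).
Implicit Types (Z : set 'M[K]_(h.+1, n)).

(** There are r polynomials of multidegree (TE, .., TE) that are linearly
independent as functions on Z: a lower bound on the value at T of the Hilbert
function of Z. *)
Definition independent Z (T r : nat) : Prop :=
  exists2 g : 'I_r -> {mpoly K[h.+1 * n]},
    forall i, mhomog (fun=> T * E)%N (g i) &
    forall c : 'I_r -> K,
      (forall x, Z x -> mxeval (\sum_i c i *: g i) x = 0) -> forall i, c i = 0.

Lemma independent_sub Z Z' T r :
  Z `<=` Z' -> independent Z T r -> independent Z' T r.
Proof.
by move=> sZ [g hg H]; exists g => // c hc; apply: H => x /sZ; exact: hc.
Qed.

Lemma independent1 Z T x : multiproj x -> Z x -> independent Z T 1.
Proof.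
move=> hx Zx.
have f1 : mxeval (1 : {mpoly K[h.+1 * n]}) x != 0.
  by rewrite /mxeval meval1 oner_neq0.
have [|g [hg gx _]] :=
  raise_multidegree (@mhomog1 K h.+1 n) (E := T * E) _ hx f1.
  by [].
exists (fun=> g) => // c /(_ x Zx); rewrite big_ord1 mxevalZ => /eqP.
by rewrite mulf_eq0 (negbTE gx) orbF => /eqP c0 i; rewrite ord1.
Qed.

(** The exact sequence behind dim Z' < dim Z: multiplication by f is injective on
functions on Z, because Z is irreducible, and its image vanishes on Z'.  So
independent functions on Z' and f times independent functions on Z remain
independent together. *)
Lemma independentD Z Z' T r r' (f : {mpoly K[h.+1 * n]}) z :
  irreducible_closed Z -> Z' `<=` Z -> mhomog (fun=> E) f ->
  (forall x, Z' x -> mxeval f x = 0) -> Z z -> mxeval f z != 0 ->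
  independent Z' T.+1 r -> independent Z T r' -> independent Z T.+1 (r + r').
Proof.
move=> irrZ sZ hf f0 Zz fz [g hg indg] [g' hg' indg'].
pose G (i : 'I_(r + r')) :=
  match fintype.split i with inl i => g i | inr i => f * g' i end.
have Gl i : G (lshift r' i) = g i.
  by rewrite /G (_ : fintype.split _ = inl i) //; exact: (unsplitK (inl i)).
have Gr i : G (rshift r i) = f * g' i.
  by rewrite /G (_ : fintype.split _ = inr i) //; exact: (unsplitK (inr i)).
exists G => [i|c hc].
  rewrite /G; case: fintype.split => {}i; first exact: hg.
  by move=> u /(mhomogM hf (hg' i)) hu j; rewrite hu mulSn.
have hc' x : Z x -> mxeval (\sum_i c (lshift r' i) *: g i) x +
    mxeval f x * mxeval (\sum_i c (rshift r i) *: g' i) x = 0.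
  move=> Zx; rewrite -(hc x Zx) big_split_ord /= mxevalD; congr (_ + _).
    by congr (mxeval _ x); apply: eq_bigr => i _; rewrite Gl.
  rewrite -mxevalM mulr_sumr; congr (mxeval _ x); apply: eq_bigr => i _.
  by rewrite Gr scalerAr.
have cl : forall i, c (lshift r' i) = 0.
  apply: indg => x Z'x; rewrite -(hc' x (sZ x Z'x)).
  by rewrite f0 // mul0r addr0.
have cr : forall i, c (rshift r i) = 0.
  apply: indg'.
  have [||x Zx||//] := @irreducible_mul _ _ _ Z f
      (\sum_i c (rshift r i) *: g' i) irrZ.
  - exact: mhomog_multihomog hf.
  - apply: (@mhomog_multihomog _ _ _ (fun=> T * E)%N); apply: mhomog_sum => i.
    exact: mhomogZ.
  - rewrite -(hc' x Zx) [\sum_i c (lshift r' i) *: g i]big1 => [|i _].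
      by rewrite [mxeval 0 x]meval0 add0r.
    by rewrite cl scale0r.
  - by move=> /(_ z Zz) /eqP; rewrite (negbTE fz).
by move=> i; rewrite -(splitK i); case: (fintype.split i) => j /=.
Qed.

End Independence.

(** Iterating independentD along the chain is Pascal's rule. *)
Lemma chain_independent (K : fieldType) (h n d : nat)
    (S : set 'M[K]_(h.+1, n)) x (Z : nat -> set 'M[K]_(h.+1, n)) :
  irreducible_chain S x d Z ->
  exists E, forall T, independent E (Z d) T 'C(T + d, d).
Proof.
move=> [hZ ltZ].
have pZ i y : (i <= d)%N -> Z i y -> multiproj y.
  by move=> /hZ[[[F [_ ->]] _ _] _ _] [].
have hx : multiproj x by apply: (pZ 0%N) => //; case: (hZ 0%N).
have sep (i : 'I_d) : exists fze : {mpoly K[h.+1 * n]} * 'M[K]_(h.+1, n) *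
      ('I_n -> nat),
    [/\ mhomog fze.2 fze.1.1, forall y, Z i y -> mxeval fze.1.1 y = 0,
        Z i.+1 fze.1.2 & mxeval fze.1.1 fze.1.2 != 0].
  have [_ nsub] := ltZ i (ltn_ord i).
  apply/not_existsP => H; apply: nsub => y Zy.
  have [[[F [hF ZE]] _ _] _ _] := hZ i (ltnW (ltn_ord i)).
  rewrite ZE; split; first exact: (pZ i.+1 y (ltn_ord i) Zy).
  move=> f Ff; apply/eqP/negPn/negP => fy.
  have [e he] := hF f Ff; apply: (H (f, y, e)); split=> // w.
  by rewrite ZE => -[_]; exact.
have [fze hfze] := choice sep.
(* A common bound on the degrees of the separating polynomials of all steps. *)
pose E := (\max_(i < d) \max_(j < n) (fze i).2 j)%N.
exists E.
suff ind i T : (i <= d)%N -> independent E (Z i) T 'C(T + i, i).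
  by move=> T; apply: ind.
elim: i T => [|i IHi] T id.
  rewrite bin0; apply: (independent1 _ _ hx).
  by case: (hZ 0%N).
have Zx : Z i.+1 x by case: (hZ i.+1 id).
have [he f0 Zz fz] := hfze (Ordinal id).
have eE j : ((fze (Ordinal id)).2 j <= E)%N.
  apply: leq_trans (leq_bigmax (Ordinal id)).
  exact: (leq_bigmax (F := fun j => (fze (Ordinal id)).2 j)).
have [f [hf fz' f0']] := raise_multidegree he eE (pZ _ _ id Zz) fz.
elim: T => [|T IHT]; first by rewrite binn; exact: independent1 hx Zx.
rewrite addSn binS addnC addnS.
apply: (@independentD _ _ _ _ (Z i.+1) (Z i) _ _ _ f _ _ _ hf _ Zz fz') => //.
- by case: (hZ i.+1 id).
- by case: (ltZ i id).
- by move=> y Zy; apply: f0'; exact: f0.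
- rewrite -addSn; apply: IHi; exact: ltnW.
- by rewrite -addnS.
Qed.

Lemma resectioning_image_multiproj (K : fieldType) (N h n : nat)
    (X : 'M[K]_(N.+1, n)) : resectioning_image h X `<=` @multiproj K h n.
Proof. by move=> x []. Qed.

(** A polynomial on S is determined by its pullback along C |-> CX, a form of
degree nTE in the four entries of C. *)
Lemma independent_resectioning (K : fieldType) (n E T r : nat)
    (X : 'M[K]_(2, n)) :
  independent E (resectioning_variety 1 X) T r ->
  (r <= 'C(n * (T * E) + 3, 3))%N.
Proof.
move=> [g hg ind].
pose D := (n * (T * E))%N.
pose gen : 'M[{mpoly K[2 * 2]}]_2 := \matrix_(i, j) 'X_(mxvec_index i j).
pose lq := [tuple mxvec (gen *m map_mx (@mpolyC (2 * 2) K) X) 0 k | k < 2 * n].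
have lqE (C : 'M[K]_2) k :
    (tnth lq k).@[fun i => mxvec C 0 i] = mxvec (C *m X) 0 k.
  rewrite tnth_mktuple; case/mxvec_indexP: k => i j; rewrite !mxvecE !mxE.
  rewrite raddf_sum; apply: eq_bigr => l _.
  by rewrite /= !mxE mevalM mevalXU mevalC mxvecE.
have lqh k : tnth lq k \is 1.-homog.
  rewrite tnth_mktuple; case/mxvec_indexP: k => i j; rewrite mxvecE mxE.
  apply: rpred_sum => l _; rewrite !mxE mulrC mul_mpolyC; apply: rpredZ.
  by rewrite dhomogX /= mdeg1.
have hG i : g i \mPo lq \is D.-homog.
  have /dhomogP hgi := mhomog_dhomog (hg i).
  rewrite comp_mpolyEX big_seq; apply: rpred_sum => u /hgi /= hu.
  apply: rpredZ; rewrite comp_mpolyX.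
  have -> : D = (\sum_(i < 2 * n) u i)%N.
    by rewrite -mdegE hu sum_nat_const card_ord.
  elim/big_rec2: _ => [|k p e _ hp]; first exact: dhomog1.
  apply: dhomogM => //; have := dhomogMn (u k) (lqh k); by rewrite mul1n.
pose V := [tuple DHomog (hG i) | i < r].
have freeV : free V.
  apply/freeP => c hc; apply: ind => x.
  rewrite /resectioning_variety zariski_closureE; last first.
    exact: resectioning_image_multiproj.
  have hsum : mhomog (fun=> T * E)%N (\sum_i c i *: g i).
    by apply: mhomog_sum => i; exact: mhomogZ.
  move=> [_]; apply; first exact: mhomog_multihomog hsum.
  move=> _ [_ [C [a [_ ->]]]]; rewrite (mxeval_scale _ _ hsum).
  suff -> : mxeval (\sum_i c i *: g i) (C *m X) = 0 by rewrite mulr0.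
  have -> : mxeval (\sum_i c i *: g i) (C *m X) =
     (mpoly_of_dhomog (\sum_i c i *: V`_i)).@[fun k => mxvec C 0 k].
    rewrite mxeval_sum !raddf_sum; apply: eq_bigr => i _ /=.
    rewrite mxevalZ linearZ /= (nth_map i) ?size_enum_ord // nth_ord_enum /=.
    rewrite comp_mpoly_meval; congr (_ * _).
    by apply: meval_eq => k; rewrite lqE.
  by rewrite hc !raddf0.
have := dimvS (subvf <<V>>%VS).
move: freeV; rewrite /free size_tuple => /eqP ->.
by rewrite dimvf -(bin_sub (leq_addl _ 3)) addnK.
Qed.

Lemma binomial_growth d : exists T, ('C(d * T + 3, 3) < 'C(T + 4, 4))%N.
Proof.
(* Compare (T + 1)^4 / 24 with ((d + 3)(T + 1))^3 / 6. *)
exists (4 * (d + 3) ^ 3)%N; set T := (4 * _)%N.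
have lowB : ((T.+1 ^ 4) <= 'C(T + 4, 4) * 4`!)%N.
  rewrite bin_ffact addn4 !ffactnS ffactn0 /= !expnS expn0.
  by rewrite !leq_mul // ?ltnS ?leqnSn // -?addn4; lia.
have upB : ('C(d * T + 3, 3) * 3`! <= ((d + 3) * T.+1) ^ 3)%N.
  rewrite bin_ffact addn3 !ffactnS ffactn0 /= !expnS expn0.
  by rewrite !leq_mul //; nia.
rewrite -(ltn_pmul2r (fact_gt0 4)); apply: leq_trans lowB.
have -> : ('C(d * T + 3, 3) * 4`! = 4 * ('C(d * T + 3, 3) * 3`!))%N.
  by rewrite (_ : 4`! = 4 * 3`!)%N // mulnCA.
apply: (@leq_ltn_trans (4 * ((d + 3) * T.+1) ^ 3)); first by rewrite leq_pmul2l.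
by rewrite expnMn mulnA -/T [(T.+1 ^ 4)%N]expnS ltn_pmul2r ?expn_gt0.
Qed.

(** A chain of length 4 would make the Hilbert function of S grow like T^4. *)
Lemma chain_le3 (K : fieldType) (n d : nat) (X : 'M[K]_(2, n)) x
    (Z : nat -> set 'M[K]_(2, n)) :
  irreducible_chain (resectioning_variety 1 X) x d Z -> (d <= 3)%N.
Proof.
move=> [hZ ltZ]; rewrite leqNgt; apply/negP => d3.
have ch4 : irreducible_chain (resectioning_variety 1 X) x 4 Z.
  split=> i i4; [apply: hZ|apply: ltZ]; exact: leq_trans d3.
have [E ind] := chain_independent ch4.
have sZ : Z 4%N `<=` resectioning_variety 1 X by have [] := ch4.1 4%N (leqnn 4).
have [T] := binomial_growth (n * E).
rewrite ltnNge => /negP; apply; rewrite -mulnA [(E * T)%N]mulnC.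
exact: independent_resectioning (independent_sub sZ (ind T)).
Qed.

(** * Minors and cross-ratios *)

Definition det2 (K : pzRingType) (u v : 'cV[K]_2) : K :=
  u 0 0 * v 1 0 - u 1 0 * v 0 0.

Definition minor2 (K : pzRingType) (n : nat) (x : 'M[K]_(2, n)) i j : K :=
  det2 (col i x) (col j x).

Lemma minor2E (K : pzRingType) (n : nat) (x : 'M[K]_(2, n)) i j :
  minor2 x i j = x 0 i * x 1 j - x 1 i * x 0 j.
Proof. by rewrite /minor2 /det2 !mxE. Qed.

Lemma ord2P (r : 'I_2) : r = 0 \/ r = 1.
Proof. by case: r => [[|[|]]] // ?; [left|right]; apply: val_inj. Qed.

Lemma sum2E (K : nmodType) (F : 'I_2 -> K) : \sum_r F r = F 0 + F 1.
Proof.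
by rewrite big_ord_recl big_ord1; congr (_ + F _); apply: val_inj.
Qed.

(** The factor is the determinant of C, up to column scalings. *)
Lemma minor2_mulC (K : comPzRingType) (n : nat) (C : 'M[K]_2)
    (X : 'M[K]_(2, n)) (a : 'rV[K]_n) i j :
  minor2 (C *m X *m diag_mx a) i j =
  a 0 i * a 0 j * minor2 C 0 1 * minor2 X i j.
Proof. by rewrite !minor2E !mul_mx_diag !mxE !sum2E; ring. Qed.

Section Det2.
Variable K : fieldType.
Implicit Types u v w : 'cV[K]_2.

Lemma det2_parallel u v : u != 0 -> det2 u v = 0 -> exists c, v = c *: u.
Proof.
move=> /cV0Pn[r ur] /eqP; rewrite subr_eq0 => /eqP uv.
exists (v r 0 / u r 0); apply/colP => s; rewrite !mxE mulrAC.
apply: (canRL (mulfK ur)).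
by case: (ord2P r) (ord2P s) => -> [] -> //; rewrite !(mulrC (v _ _)) uv.
Qed.

Lemma det2_transverse u : u != 0 -> exists v, det2 u v != 0.
Proof.
move=> /cV0Pn[r ur]; exists (\col_s (s != r)%:R); rewrite /det2 !mxE.
case: (ord2P r) ur => -> ur; first by rewrite mulr1 mulr0 subr0.
by rewrite mulr0 mulr1 sub0r oppr_eq0.
Qed.

(** Pairing with w kills the first summand. *)
Lemma det2_comb_neq0 u w (b c : K) :
  det2 u w != 0 -> c != 0 -> b *: w + c *: u != 0.
Proof.
move=> uw c0; apply/eqP => E.
have : det2 (b *: w + c *: u) w = c * det2 u w by rewrite /det2 !mxE; ring.
rewrite E /det2 !mxE !mul0r subr0 => /esym/eqP.
by rewrite mulf_eq0 (negbTE c0) (negbTE uw).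
Qed.

End Det2.

Lemma general_position_minor2 (K : fieldType) (n : nat) (X : 'M[K]_(2, n)) :
  multiproj X -> general_position X ->
  forall i j, i != j -> minor2 X i j != 0.
Proof.
move=> hX gp i j ij; apply/eqP; rewrite minor2E => Xij; apply: gp.
exists (fun r : 'I_2 => if r == 0 then i else j).
exists (\row_r (if r == 0 then - X 1 i else X 0 i)); split.
- move=> r s; case: (ord2P r) (ord2P s) => -> [] -> //=.
    by move=> E; rewrite E eqxx in ij.
  by move=> E; rewrite E eqxx in ij.
- have /cV0Pn[r] := hX i; rewrite mxE => Xr; apply/eqP => /rowP H.
  have := H 0; have := H 1; rewrite !mxE /= => H0 H1.
  case: (ord2P r) Xr => ->; first by rewrite H0 eqxx.
  by rewrite -oppr_eq0 H1 eqxx.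
- move=> r; apply/matrixP => p q; rewrite !mxE sum2E !mxE /=.
  case: (ord2P r) => -> /=; first by ring.
  by rewrite -[RHS]Xij; ring.
Qed.

Lemma rank1_minor2 (K : fieldType) (n : nat) (x : 'M[K]_(2, n)) :
  \rank x = 1%N -> forall i j, minor2 x i j = 0.
Proof.
move=> rx i j; have := mulmx_base x.
move: (col_base x) (row_base x); rewrite rx => u v <-.
by rewrite minor2E !mxE !big_ord1; ring.
Qed.

Lemma minor2_rank1 (K : fieldType) (n : nat) (x : 'M[K]_(2, n)) :
  (0 < n)%N -> multiproj x -> (forall i j, minor2 x i j = 0) -> \rank x = 1%N.
Proof.
case: n x => // n x _ hx x0; apply/eqP; rewrite eqn_leq; apply/andP; split.
  have /choice[c hc] j := det2_parallel (hx 0) (x0 0 j).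
  suff -> : x = col 0 x *m \row_j c j by exact: mulmx_max_rank.
  apply/matrixP => r j; rewrite mxE big_ord1 !mxE.
  by have /colP/(_ r) := hc j; rewrite !mxE mulrC.
rewrite lt0n mxrank_eq0; apply: contra (hx 0) => /eqP ->.
by apply/eqP/colP => r; rewrite !mxE.
Qed.

Section CrossRatio.
Variables (K : fieldType) (n : nat) (X : 'M[K]_(2, n)).
Implicit Types (i j k l : 'I_n) (x : 'M[K]_(2, n)).

Definition minor2_mpoly i j : {mpoly K[2 * n]} :=
  'X_(mxvec_index 0 i) * 'X_(mxvec_index 1 j) +
  (-1) *: ('X_(mxvec_index 1 i) * 'X_(mxvec_index 0 j)).

Lemma mxeval_minor2 i j x : mxeval (minor2_mpoly i j) x = minor2 x i j.
Proof. by rewrite mxevalD mxevalZ !mxevalM !mxevalX minor2E mulN1r. Qed.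

Lemma mhomog_minor2 i j :
  mhomog (fun l => (l == i) + (l == j))%N (minor2_mpoly i j).
Proof.
by apply: mhomogD; last apply: mhomogZ; apply: mhomogM; apply: mhomogX.
Qed.

(** The equation saying that the columns i, k, l, j have the same cross-ratio as
those of X, cleared of denominators. *)
Definition cross_mpoly i k l j : {mpoly K[2 * n]} :=
  (minor2 X i l * minor2 X k j) *: (minor2_mpoly i k * minor2_mpoly l j) +
  (- (minor2 X i k * minor2 X l j)) *: (minor2_mpoly i l * minor2_mpoly k j).

Lemma mxeval_cross i k l j x : mxeval (cross_mpoly i k l j) x =
  minor2 X i l * minor2 X k j * (minor2 x i k * minor2 x l j) -
  minor2 X i k * minor2 X l j * (minor2 x i l * minor2 x k j).
Proof. by rewrite mxevalD !mxevalZ !mxevalM !mxeval_minor2 mulNr. Qed.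

Lemma multihomog_cross i k l j : multihomog (cross_mpoly i k l j).
Proof.
have h a b c d := mhomogM (@mhomog_minor2 a b) (@mhomog_minor2 c d).
apply: mhomog_multihomog; apply: mhomogD; apply: mhomogZ; first exact: h.
by move=> u /h hu p; rewrite hu; lia.
Qed.

Lemma cross_vanishes i k l j x :
  resectioning_variety 1 X x -> mxeval (cross_mpoly i k l j) x = 0.
Proof.
rewrite /resectioning_variety zariski_closureE; last first.
  exact: resectioning_image_multiproj.
move=> [_]; apply; first exact: multihomog_cross.
move=> _ [_ [C [a [_ ->]]]].
by rewrite mxeval_cross !minor2_mulC; ring.
Qed.

Lemma resectioning_variety_multiproj :
  resectioning_variety 1 X `<=` @multiproj K 1 n.
Proof.
rewrite /resectioning_variety zariski_closureE => [x []//|].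
exact: resectioning_image_multiproj.
Qed.

Lemma resectioning_variety_closed : zariski_closed (resectioning_variety 1 X).
Proof. exact/zariski_closure_closed/resectioning_image_multiproj. Qed.

End CrossRatio.

(** * A parametrization around the points off the diagonal *)

Section Family.
Variables (K : numFieldType) (n : nat) (X : 'M[K]_(2, n)) (i k j : 'I_n).
Hypothesis X_neq0 : forall a b, a != b -> minor2 X a b != 0.
Hypotheses (ik : i != k) (ij : i != j) (kj : k != j).
Implicit Types (u v w : 'cV[K]_2) (a : 'rV[K]_n) (x : 'M[K]_(2, n)).

Local Notation S := (resectioning_variety 1 X).

(** The solution y_l of the cross-ratio equation for i, k, l, j with y_i = u,
y_k = v, y_j = w, which is linear in y_l.  For l = j the formula would give a
multiple of w by det2 u v, which vanishes when u and v are parallel; w itself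
is taken instead. *)
Definition chart_col u v w l : 'cV[K]_2 :=
  if l == j then w else
    (minor2 X i l * minor2 X k j * det2 u v) *: w +
    (minor2 X i k * minor2 X l j * det2 v w) *: u.

Definition chart u v w a : 'M[K]_(2, n) :=
  \matrix_(r, l) (a 0 l * chart_col u v w l r 0).

Lemma col_chart u v w a l :
  col l (chart u v w a) = a 0 l *: chart_col u v w l.
Proof. by apply/colP => r; rewrite !mxE. Qed.

Lemma chart_col_neq0 u v w l :
  det2 v w != 0 -> det2 u w != 0 -> chart_col u v w l != 0.
Proof.
move=> vw uw; rewrite /chart_col; case: (eqVneq l j) => [_|lj].
  by apply: contraNneq vw => ->; rewrite /det2 !mxE !mulr0 subr0.
by apply: det2_comb_neq0 => //; rewrite !mulf_neq0 ?X_neq0.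
Qed.

Lemma chart_multiproj u v w a :
  det2 v w != 0 -> det2 u w != 0 -> (forall l, a 0 l != 0) ->
  multiproj (chart u v w a).
Proof.
by move=> vw uw a0 l; rewrite col_chart scaler_eq0 negb_or a0 chart_col_neq0.
Qed.

(** For l <> j the formula defining chart_col is linear in column l of X, so it
is given by a 2 x 2 matrix C. *)
Lemma chart_image u v w a :
  det2 u v != 0 -> det2 v w != 0 -> det2 u w != 0 ->
  multiproj (chart u v w a) -> resectioning_image 1 X (chart u v w a).
Proof.
move=> uv vw uw hF; split=> //.
pose b := minor2 X k j * det2 u v; pose c := minor2 X i k * det2 v w.
pose C : 'M[K]_2 := \matrix_(r, s)
  (b * w r 0 * (if s == 0 then - X 1 i else X 0 i) +
   c * u r 0 * (if s == 0 then X 1 j else - X 0 j)).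
(* C maps column j of X to this multiple of w. *)
pose a' : 'rV[K]_n :=
  \row_l (if l == j then a 0 l / (minor2 X i j * b) else a 0 l).
have b0 : minor2 X i j * b != 0 by rewrite !mulf_neq0 ?X_neq0.
have E : chart u v w a = C *m X *m diag_mx a'.
  apply/matrixP => r l; rewrite mul_mx_diag !mxE sum2E !mxE /= /chart_col.
  case: (eqVneq l j) => [->|_]; last by rewrite !mxE /b /c !minor2E; ring.
  apply: (mulIf b0); rewrite -[RHS]mulrA divfK // /b.
  by rewrite /c !minor2E; ring.
exists C, a'; split=> // l; apply: contra (hF l) => /eqP/colP H.
apply/eqP/colP => r; have := H r.
by rewrite E mul_mx_diag !mxE => ->; rewrite mul0r.
Qed.

Definition line m p (A B : 'M[K]_(m, p)) (s : K) := (1 - s) *: A + s *: B.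

Lemma line0 m p (A B : 'M[K]_(m, p)) : line A B 0 = A.
Proof. by rewrite /line subr0 scale1r scale0r addr0. Qed.
Lemma line1 m p (A B : 'M[K]_(m, p)) : line A B 1 = B.
Proof. by rewrite /line subrr scale0r scale1r add0r. Qed.
Lemma line_id m p (A : 'M[K]_(m, p)) s : line A A s = A.
Proof. by rewrite /line -scalerDl subrK scale1r. Qed.

Lemma polycurve_line m p (A B : 'M[K]_(m, p)) : polycurve (line A B).
Proof.
move=> r c; exists ((1 - 'X) * (A r c)%:P + 'X * (B r c)%:P) => s.
by rewrite !mxE !hornerE.
Qed.

Lemma polyfun_det2 (u v : K -> 'cV[K]_2) :
  polycurve u -> polycurve v -> polyfun (fun s => det2 (u s) (v s)).
Proof.
by move=> hu hv; apply: polyfunD; [|apply: polyfunN]; apply: polyfunM.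
Qed.

Lemma polycurve_chart (u v w : K -> 'cV[K]_2) (a : K -> 'rV[K]_n) :
  polycurve u -> polycurve v -> polycurve w -> polycurve a ->
  polycurve (fun s => chart (u s) (v s) (w s) (a s)).
Proof.
move=> hu hv hw ha r l.
suff [p hp] : polyfun (fun s => a s 0 l * chart_col (u s) (v s) (w s) l r 0).
  by exists p => s; rewrite -hp mxE.
apply: polyfunM => //; rewrite /chart_col; case: eqP => // _.
set b := minor2 X i l * _; set c := minor2 X i k * _.
have [p hp] : polyfun (fun s => b * det2 (u s) (v s) * w s r 0 +
    c * det2 (v s) (w s) * u s r 0).
  by apply: polyfunD; apply: polyfunM => //; apply: polyfunM;
    by [exact: polyfun_cst|exact: polyfun_det2].
by exists p => s; rewrite -hp !mxE.
Qed.

(** Parallel u and v are reached as limits along a line from a triple of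
pairwise independent vectors. *)
Lemma chart_variety u v w a :
  multiproj (chart u v w a) -> S (chart u v w a).
Proof.
move=> hF.
(* Any triple of pairwise independent vectors serves as the other end. *)
pose u1 : 'cV[K]_2 := \col_r (r == 0)%:R.
pose v1 : 'cV[K]_2 := \col_r (r == 1)%:R.
pose w1 : 'cV[K]_2 := \col_r 1.
pose c s := chart (line u u1 s) (line v v1 s) (line w w1 s) a.
have c0 : c 0 = chart u v w a by rewrite /c !line0.
have hL := polycurve_line.
have hc : polycurve c.
  by apply: polycurve_chart => //; move=> r l; exact: polyfun_cst.
rewrite -c0; apply: closed_curve hc _ _; last by rewrite c0.
  exact: resectioning_variety_closed.
have uv : det2 (line u u1 1) (line v v1 1) != 0.
  by rewrite !line1 /det2 !mxE /= mulr1 mul0r subr0 oner_eq0.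
have vw : det2 (line v v1 1) (line w w1 1) != 0.
  by rewrite !line1 /det2 !mxE /= mul0r mul1r sub0r oppr_eq0 oner_eq0.
have uw : det2 (line u u1 1) (line w w1 1) != 0.
  by rewrite !line1 /det2 !mxE /= mul0r mul1r subr0 oner_eq0.
have det_cof (A A' B B' : 'cV[K]_2) := cofinitely_neq0
  (polyfun_det2 (hL _ _ A A') (hL _ _ B B')).
apply: cofinitely_imp (cofinitely_and (det_cof _ _ _ _ _ uv)
  (cofinitely_and (det_cof _ _ _ _ _ vw) (det_cof _ _ _ _ _ uw))).
move=> s [uvs [vws uws]] hm; apply: sub_zariski_closure.
exact: chart_image.
Qed.

Lemma cross_chart x :
  multiproj x -> minor2 x i j != 0 -> minor2 x k j != 0 ->
  (forall l, mxeval (cross_mpoly X i k l j) x = 0) ->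
  exists2 a, x = chart (col i x) (col k x) (col j x) a &
    forall l, a 0 l != 0.
Proof.
move=> hx xij xkj cr.
have /choice[c hc] : forall l, exists c,
    col l x = c *: chart_col (col i x) (col k x) (col j x) l.
  move=> l; apply: det2_parallel.
    exact: chart_col_neq0.
  rewrite /chart_col; case: eqP => [->|_].
    by rewrite /det2; ring.
  rewrite -[RHS]oppr0 -[X in - X](cr l) mxeval_cross /minor2 /det2 !mxE.
  by ring.
exists (\row_l c l) => [|l].
  apply/matrixP => r l; have /colP/(_ r) := hc l.
  by rewrite !mxE => ->.
by apply: contra (hx l); rewrite mxE hc => /eqP ->; rewrite scale0r.
Qed.

End Family.

(** * Points off the diagonal *)

Section OffDiagonal.
Variables (K : numFieldType) (n : nat) (X : 'M[K]_(2, n)) (i k j : 'I_n).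
Hypothesis X_neq0 : forall a b, a != b -> minor2 X a b != 0.
Hypotheses (ik : i != k) (ij : i != j) (kj : k != j).
Variable x : 'M[K]_(2, n).
Hypotheses (xij : minor2 x i j != 0) (xkj : minor2 x k j != 0).

Local Notation S := (resectioning_variety 1 X).

(** At level m the last 3 - m of the columns i, k, j (in this order) are fixed
to those of x and the other ones are free. *)
Definition subchart (m : nat) : set 'M[K]_(2, n) :=
  [set y | multiproj y /\ exists u v w a, y = chart X i k j u v w a /\
    [/\ (m < 3)%N -> w = col j x, (m < 2)%N -> v = col k x &
        (m < 1)%N -> u = col i x]].

Lemma subchart_multiproj m : subchart m `<=` @multiproj K 1 n.
Proof. by move=> y []. Qed.

(** The parameters range over an affine space, so lines join them. *)
Lemma subchart_link m y z : subchart m y -> subchart m z ->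
  exists c, [/\ polycurve c, c 0 = y, c 1 = z &
    forall s, multiproj (c s) -> subchart m (c s)].
Proof.
move=> [_ [u [v [w [a [-> [hw hv hu]]]]]]].
move=> [_ [u' [v' [w' [a' [-> [hw' hv' hu']]]]]]].
exists (fun s => chart X i k j (line u u' s) (line v v' s) (line w w' s)
  (line a a' s)); split.
- by apply: polycurve_chart; exact: polycurve_line.
- by rewrite !line0.
- by rewrite !line1.
- move=> s hs; split=> //; do 4!eexists; split; first reflexivity.
  by split=> hm; rewrite ?(hw hm) ?(hw' hm) ?(hv hm) ?(hv' hm) ?(hu hm)
    ?(hu' hm) line_id.
Qed.

Definition linear_mpoly (p : 'cV[K]_2) (l : 'I_n) : {mpoly K[2 * n]} :=
  p 0 0 *: 'X_(mxvec_index 1 l) + (- p 1 0) *: 'X_(mxvec_index 0 l).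

Lemma mxeval_linear p l y : mxeval (linear_mpoly p l) y = det2 p (col l y).
Proof. by rewrite mxevalD !mxevalZ !mxevalX /det2 !mxE mulNr. Qed.

Lemma multihomog_linear p l : multihomog (linear_mpoly p l).
Proof.
apply: (@mhomog_multihomog _ _ _ (fun j => j == l)).
by apply: mhomogD; apply: mhomogZ; exact: mhomogX.
Qed.

Lemma det2Z (u v : 'cV[K]_2) c : det2 u (c *: v) = c * det2 u v.
Proof. by rewrite /det2 !mxE; ring. Qed.

Lemma col_chart_i u v w a : col i (chart X i k j u v w a) =
  (a 0 i * (minor2 X i k * minor2 X i j * det2 v w)) *: u.
Proof.
rewrite col_chart /chart_col (negbTE ij) -[RHS]scalerA; congr (_ *: _).
have -> : minor2 X i i = 0 by rewrite minor2E; ring.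
by rewrite !mul0r scale0r add0r.
Qed.

Lemma col_chart_k u v w a : col k (chart X i k j u v w a) =
  (a 0 k * (minor2 X i k * minor2 X k j * det2 u w)) *: v.
Proof.
apply/colP => r; rewrite col_chart /chart_col (negbTE kj) !mxE /det2.
by case: (ord2P r) => ->; ring.
Qed.

Lemma col_chart_j u v w a :
  col j (chart X i k j u v w a) = a 0 j *: w.
Proof. by rewrite col_chart /chart_col eqxx. Qed.

(** The closures of the subcharts are distinct because at level m one more column
stays parallel to the corresponding column of x than at level m + 1. *)
Lemma offdiagonal_chain : S x ->
  irreducible_chain S x 3 (fun m => zariski_closure (subchart m)).
Proof.
move=> Sx; have hx := resectioning_variety_multiproj Sx.
have [a xE a0] : exists2 a,
    x = chart X i k j (col i x) (col k x) (col j x) a & forall l, a 0 l != 0.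
  by apply: cross_chart => // l; exact: cross_vanishes.
have Fx m : subchart m x.
  by split=> //; exists (col i x), (col k x), (col j x), a.
have sFS m : subchart m `<=` S.
  by move=> y [hy [u [v [w [b [yE _]]]]]]; rewrite yE in hy *;
     exact: chart_variety.
split=> m hm.
  split.
  - apply: irreducible_closure; first exact: subchart_multiproj.
      by exists x.
    exact: subchart_link.
  - by apply: zariski_closure_min => //; exact: resectioning_variety_closed.
  - exact: sub_zariski_closure.
split.
  apply: zariski_closure_min.
    exact/zariski_closure_closed/subchart_multiproj.
  move=> y [hy [u [v [w [b [yE [hw hv hu]]]]]]]; apply: sub_zariski_closure.
  split=> //; exists u, v, w, b; split=> //.
  by split=> lm; [apply: hw|apply: hv|apply: hu]; exact: ltnW.
have one0 (l : 'I_n) : (const_mx 1 : 'rV[K]_n) 0 l != 0.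
  by rewrite mxE oner_eq0.
have sep p l u v w : (forall y, subchart m y -> det2 p (col l y) = 0) ->
    det2 v w != 0 -> det2 u w != 0 ->
    det2 p (col l (chart X i k j u v w (const_mx 1))) != 0 ->
    [/\ (m.+1 < 3)%N -> w = col j x, (m.+1 < 2)%N -> v = col k x &
        (m.+1 < 1)%N -> u = col i x] ->
    ~ zariski_closure (subchart m.+1) `<=` zariski_closure (subchart m).
  move=> h0 vw uw hp hm1 sub.
  have hF : multiproj (chart X i k j u v w (const_mx 1)).
    exact: chart_multiproj.
  have /sub : zariski_closure (subchart m.+1)
      (chart X i k j u v w (const_mx 1)).
    apply: sub_zariski_closure; split=> //.
    by exists u, v, w, (const_mx 1).
  rewrite zariski_closureE; last exact: subchart_multiproj.
  case=> _ /(_ _ (multihomog_linear p l)); rewrite mxeval_linear => H.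
  by move: hp; rewrite H ?eqxx // => y /h0; rewrite mxeval_linear.
have det2vv (p : 'cV[K]_2) : det2 p p = 0 by rewrite /det2; ring.
have comb (p q : 'cV[K]_2) : det2 p (p + q) = det2 p q.
  by rewrite /det2 !mxE; ring.
have combl (p q : 'cV[K]_2) : det2 (p + q) q = det2 p q.
  by rewrite /det2 !mxE; ring.
have X1 (a1 b1 : 'I_n) (p : K) : a1 != b1 -> p != 0 ->
    minor2 X i k * minor2 X a1 b1 * p != 0.
  by move=> ab p0; rewrite !mulf_neq0 ?X_neq0.
case: m hm sep => [|[|[|//]]] _ sep.
- apply: (sep (col i x) i (col i x + col j x) (col k x) (col j x)) => //.
  + move=> y [_ [u [v [w [b [-> [_ _ /(_ isT) ->]]]]]]].
    by rewrite col_chart_i det2Z det2vv mulr0.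
  + by rewrite combl.
  + by rewrite col_chart_i det2Z comb mxE mul1r mulf_neq0 ?X1.
- apply: (sep (col k x) k (col i x) (col k x + col j x) (col j x)) => //.
  + move=> y [_ [u [v [w [b [-> [_ /(_ isT) -> _]]]]]]].
    by rewrite col_chart_k det2Z det2vv mulr0.
  + by rewrite combl.
  + by rewrite col_chart_k det2Z comb mxE mul1r mulf_neq0 ?X1.
- have xji : det2 (col j x) (col i x) != 0.
    by rewrite -oppr_eq0; move: xij; rewrite /minor2 /det2; congr (_ != _); ring.
  have iij : det2 (col i x) (col j x + col i x) = minor2 x i j.
    by rewrite addrC comb.
  apply: (sep (col j x) j (col i x) (col i x) (col j x + col i x)) => //.
  + move=> y [_ [u [v [w [b [-> [/(_ isT) -> _ _]]]]]]].
    by rewrite col_chart_j det2Z det2vv mulr0.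
  + by rewrite iij.
  + by rewrite iij.
  + by rewrite col_chart_j det2Z comb mxE mul1r.
Qed.

End OffDiagonal.

Section Coordinates.
Variables (K : fieldType) (n q : nat) (r : 'I_n -> 'I_2) (t : 'I_q -> 'I_n).

(** One coordinate in each column, and the other one in the columns listed by
t. *)
Definition coordinates (v : 'M[K]_(2, n)) : 'rV[K]_(n + q) :=
  row_mx (\row_l v (r l) l) (\row_p v (rev_ord (r (t p))) (t p)).

Lemma coordinates_is_linear : linear coordinates.
Proof.
move=> c u v; rewrite /coordinates scale_row_mx add_row_mx.
by congr row_mx; apply/rowP => l; rewrite !mxE.
Qed.

HB.instance Definition _ := GRing.isLinear.Build K 'M[K]_(2, n)
  'rV[K]_(n + q) _ coordinates coordinates_is_linear.

Lemma dim_le_coordinates (T : {vspace 'M[K]_(2, n)}) :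
  (forall v, v \in T -> (forall l, v (r l) l = 0) ->
     (forall p, col (t p) v = 0) -> v = 0) ->
  (\dim T <= n + q)%N.
Proof.
move=> H; rewrite -(limg_dim_eq (f := linfun coordinates)).
  by have := dimvS (subvf (linfun coordinates @: T));
    rewrite dimvf /dim /= mul1n.
apply/eqP; rewrite -subv0; apply/subvP => v; rewrite memv_cap memv0 => /andP[vT].
rewrite memv_ker lfunE /= => /eqP/rowP E.
have v1 l : v (r l) l = 0 by have := E (lshift q l); rewrite row_mxEl !mxE.
apply/eqP; apply: H => // p; apply/colP => a; rewrite !mxE.
have v2 : v (rev_ord (r (t p))) (t p) = 0.
  by have := E (rshift n p); rewrite row_mxEr !mxE.
have [->//|->//] : a = r (t p) \/ a = rev_ord (r (t p)).
by case: (ord2P a) (ord2P (r (t p))) => -> [] ->;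
  by [left | right; apply: val_inj].
Qed.

End Coordinates.

Section Tangent.
Variables (K : numFieldType) (n : nat) (X : 'M[K]_(2, n)).
Hypothesis X_neq0 : forall a b, a != b -> minor2 X a b != 0.
Implicit Types (i k j : 'I_n) (x : 'M[K]_(2, n)).

Local Notation S := (resectioning_variety 1 X).

(** The equation is affine in column l, so with columns i, k, j fixed its
differential is the linear form det2 (W, -), up to sign, where W is given by
the formula of chart_col at columns i, k, j of x. *)
Lemma differential_cross i k j l x v :
  col i v = 0 -> col k v = 0 -> col j v = 0 ->
  differential (cross_mpoly X i k l j) x v =
  - det2 ((minor2 X i l * minor2 X k j * minor2 x i k) *: col j x +
          (minor2 X i k * minor2 X l j * minor2 x k j) *: col i x) (col l v).
Proof.
have col0 a : col a v = 0 -> v 0 a = 0 /\ v 1 a = 0.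
  by move=> /colP va; have := va 0; have := va 1; rewrite !mxE.
move=> /col0[vi0 vi1] /col0[vk0 vk1] /col0[vj0 vj1].
set D := - _.
rewrite -(@differentialE _ _ _ _ _ _
  ((mxeval (cross_mpoly X i k l j) x)%:P + D *: 'X)).
  by rewrite derivD derivC add0r derivZ derivX hornerZ hornerC mulr1.
move=> s; rewrite hornerD hornerC hornerZ hornerX !mxeval_cross /D.
rewrite ![minor2 (x + _) _ _]minor2E ![minor2 x _ _]minor2E /det2 !mxE.
by rewrite vi0 vi1 vk0 vk1 vj0 vj1; ring.
Qed.

Lemma offdiagonal_tangent i k j x (T : {vspace 'M[K]_(2, n)}) :
  i != k -> i != j -> k != j -> S x ->
  minor2 x i j != 0 -> minor2 x k j != 0 ->
  cone_tangent_space S x T -> (\dim T <= n + 3)%N.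
Proof.
move=> ik ij kj Sx xij xkj hT.
pose W l := (minor2 X i l * minor2 X k j * minor2 x i k) *: col j x +
            (minor2 X i k * minor2 X l j * minor2 x k j) *: col i x.
have W0 l : l != j -> W l != 0.
  by move=> lj; apply: det2_comb_neq0 => //; rewrite !mulf_neq0 ?X_neq0.
have /choice[r hr] : forall l, exists r, l != j -> W l r 0 != 0.
  move=> l; have [lj|lj] := eqVneq l j; first by exists 0.
  by have /cV0Pn[r] := W0 l lj; exists r.
apply: (@dim_le_coordinates _ _ 3 r (tnth [tuple i; k; j])) => v vT vr vc.
have vi : col i v = 0 by exact: (vc 0).
have vk : col k v = 0 by exact: (vc 1).
have vj : col j v = 0 by exact: (vc 2%:R).
have vl l : col l v = 0.
  have [->//|lj] := eqVneq l j.
  have : det2 (W l) (col l v) = 0.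
    apply/eqP; rewrite -oppr_eq0 -differential_cross //; apply/eqP.
    apply: (hT v).1 => //; first exact: multihomog_cross.
    by move=> y; exact: cross_vanishes.
  move=> /(det2_parallel (W0 l lj))[c vE].
  have /colP/(_ (r l)) := vE; rewrite !mxE vr => /esym/eqP.
  rewrite mulf_eq0 => /orP[/eqP c0|Wr]; first by rewrite vE c0 scale0r.
  by move: (hr l lj); rewrite !mxE Wr.
by apply/matrixP => a l; have /colP/(_ a) := vl l; rewrite !mxE.
Qed.

(** * The diagonal and the singular locus *)

Lemma exists_third i j : (2 < n)%N -> exists k, k != i /\ k != j.
Proof.
move=> n3; have : (0 < #|~: [set i; j]|)%N.
  by rewrite cardsCs finset.setCK card_ord subn_gt0 cards2; case: (i != j); lia.
by case/card_gt0P => k; rewrite !inE negb_or => /andP[]; exists k.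
Qed.

(** If column j is not parallel to the other ones, x is a value of the chart with
parallel u and v.  Otherwise move column j in a transverse direction. *)
Lemma one_off_variety x j : (2 < n)%N -> multiproj x ->
  (forall a b, a != j -> b != j -> minor2 x a b = 0) -> S x.
Proof.
move=> n3 hx par.
have [i [ij _]] := exists_third j j n3.
have [k [ki kj]] := exists_third i j n3.
have ik : i != k by rewrite eq_sym.
have off y : multiproj y ->
    (forall a b, a != j -> b != j -> minor2 y a b = 0) ->
    minor2 y i j != 0 -> S y.
  move=> hy pary yij.
  have [c ck] := det2_parallel (hy i) (pary i k ij kj).
  have ykj : minor2 y k j != 0.
    rewrite /minor2 ck /det2 !mxE -!mulrA -mulrBr -minor2E mulf_neq0 //.
    by apply: contra (hy k) => /eqP c0; rewrite ck c0 scale0r.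
  have [l|a yE _] := cross_chart X_neq0 ik hy yij ykj.
    rewrite mxeval_cross (pary i k) //; have [->|lj] := eqVneq l j.
      by rewrite !minor2E; ring.
    by rewrite (pary i l) //; ring.
  by rewrite yE in hy *; exact: chart_variety.
have [q hq] := det2_transverse (hx i).
pose c s := x + s *: (q *m delta_mx 0 j).
have cE s r l : c s r l = x r l + s * (q r 0 * (l == j)%:R).
  by rewrite !mxE big_ord1 !mxE.
have hc : polycurve c.
  move=> r l; exists ((x r l)%:P + (q r 0 * (l == j)%:R) *: 'X) => s.
  by rewrite cE hornerD hornerC hornerZ hornerX mulrC.
have c0 : c 0 = x by rewrite /c scale0r addr0.
rewrite -c0; apply: closed_curve hc _ _; last by rewrite c0.
  exact: resectioning_variety_closed.
have cij s : minor2 (c s) i j = minor2 x i j + s * det2 (col i x) q.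
  rewrite !minor2E !cE /det2 !mxE (negbTE ij) eqxx !mulr0 !addr0 !mulr1; ring.
have pc : polyfun (fun s => minor2 (c s) i j).
  exists ((minor2 x i j)%:P + (det2 (col i x) q) *: 'X) => s.
  by rewrite cij hornerD hornerC hornerZ hornerX mulrC.
have [s0 s0ij] : exists s, minor2 (c s) i j != 0.
  have [xij|xij] := eqVneq (minor2 x i j) 0; last by exists 0; rewrite c0.
  by exists 1; rewrite cij xij add0r mul1r.
apply: cofinitely_imp (cofinitely_neq0 pc s0ij) => s csij cs; apply: off => //.
move=> a b aj bj; rewrite minor2E !cE (negbTE aj) (negbTE bj).
by rewrite !mulr0 !addr0 -minor2E par.
Qed.

(** Moving one column of a diagonal point along a line stays in S, so f vanishes
on these lines; their directions span the space of all matrices. *)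
Lemma diagonal_differential x v (f : {mpoly K[2 * n]}) : (2 < n)%N ->
  multiproj x -> (forall a b, minor2 x a b = 0) ->
  (forall y, S y -> mxeval f y = 0) -> differential f x v = 0.
Proof.
move=> n3 hx par hf.
have -> : differential f x v =
    \sum_j differential f x (col j v *m delta_mx 0 j).
  rewrite exchange_big; apply: eq_bigr => k _ /=; rewrite -mulr_sumr.
  congr (_ * _); case/mxvec_indexP: k => a b; rewrite mxvecE.
  rewrite (bigD1 b) //= mxvecE mxE big_ord1 !mxE !eqxx mulr1 big1 ?addr0 //.
  move=> l lb; rewrite mxvecE mxE big_ord1 !mxE.
  by rewrite [b == l]eq_sym (negbTE lb) mulr0.
apply: big1 => j _; set w := _ *m _.
rewrite -(@differentialE _ _ _ f x w 0); first by rewrite derivC horner0.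
move=> s; rewrite horner0; apply/esym; move: s.
pose c s := x + s *: w.
have hc : polycurve c.
  move=> r l; exists ((x r l)%:P + (w r l) *: 'X) => s.
  by rewrite hornerD hornerC hornerZ hornerX [in LHS]mxE [X in _ + X]mxE mulrC.
apply: (polyfun_cofinitely0 (polyfun_mxeval f hc)).
have hc0 : multiproj (c 0) by rewrite /c scale0r addr0.
apply: cofinitely_imp (cofinitely_multiproj hc hc0) => s hs; apply: hf.
apply: (one_off_variety n3 hs (j := j)) => a b aj bj.
have cE r l : l != j -> c s r l = x r l.
  by move=> lj; rewrite !mxE big_ord1 !mxE (negbTE lj) !mulr0 addr0.
by rewrite minor2E !cE // -minor2E par.
Qed.

Lemma point_chain x : S x -> exists Z, irreducible_chain S x 0 Z.
Proof.
move=> Sx; have hx := resectioning_variety_multiproj Sx.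
have h1 : [set x] `<=` @multiproj K 1 n by move=> y ->.
exists (fun=> zariski_closure [set x]); split=> // m _; split.
- apply: irreducible_closure => // [|y z -> ->]; first by exists x.
  exists (fun=> x); split=> // r c; exact: polyfun_cst.
- apply: zariski_closure_min; first exact: resectioning_variety_closed.
  by move=> y ->.
- exact: sub_zariski_closure.
Qed.

(** The lengths of chains through x are bounded and include 0, so they have a
maximum. *)
Lemma resectioning_local_dim x : S x ->
  exists2 d, local_dim S x d & (d <= 3)%N.
Proof.
move=> Sx; pose P d := `[< exists Z, irreducible_chain S x d Z >].
have exP : exists d, P d by exists 0%N; apply/asboolP; exact: point_chain.
have leP d : P d -> (d <= 3)%N by move=> /asboolP[Z /chain_le3].
case: (ex_maxnP exP leP) => d /asboolP Pd maxd; exists d.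
  by split=> // e Z hZ; apply: maxd; apply/asboolP; exists Z.
by case: Pd => Z /chain_le3.
Qed.

Lemma resectioning_singular_locus : (4 <= n)%N ->
  singular_locus S = rank_locus 1 n 1.
Proof.
move=> n4; have n3 : (2 < n)%N by exact: ltnW.
apply/seteqP; split=> x.
  move=> [Sx [d [T [[_ maxd] hT dT]]]].
  have hx := resectioning_variety_multiproj Sx.
  split=> //; apply: minor2_rank1 => //; first by apply: leq_trans n4.
  move=> a b; apply/eqP/negPn/negP => xab.
  suff [i [k [j [[ik ij kj] [xij xkj]]]]] : exists i k j,
      [/\ i != k, i != j & k != j] /\ (minor2 x i j != 0 /\ minor2 x k j != 0).
    have d3 := maxd _ _ (offdiagonal_chain X_neq0 ik ij kj xij xkj Sx).
    have T3 := offdiagonal_tangent ik ij kj Sx xij xkj hT.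
    by have := leq_trans dT T3; rewrite addnC ltn_add2l ltnNge d3.
  have ab : a != b by apply: contra xab => /eqP ->; rewrite minor2E mulrC subrr.
  have [c [ca cb]] := exists_third a b n3.
  (* Column c is not parallel to both a and b, which are independent. *)
  have [xcb|xcb] := eqVneq (minor2 x c b) 0; last first.
    by exists a, c, b; rewrite ab cb eq_sym ca.
  exists b, c, a; split; first by split=> //; rewrite eq_sym.
  have anti p q : minor2 x p q = - minor2 x q p by rewrite !minor2E; ring.
  split; first by rewrite anti oppr_eq0.
  apply/eqP => xca; case/negP: xab; rewrite minor2E subr_eq0.
  have [e bE] : exists e, col b x = e *: col c x := det2_parallel (hx c) xcb.
  have [g aE] : exists e, col a x = e *: col c x := det2_parallel (hx c) xca.
  have E (p : 'I_n) (s : K) : col p x = s *: col c x ->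
      x 0 p = s * x 0 c /\ x 1 p = s * x 1 c.
    by move=> /colP H; have := H 0; have := H 1; rewrite !mxE.
  by have [-> ->] := E _ _ bE; have [-> ->] := E _ _ aE; apply/eqP; ring.
move=> [hx /rank1_minor2 par].
have Sx : S x.
  by apply: (one_off_variety (j := Ordinal n3)).
split=> //; have [d hd d3] := resectioning_local_dim Sx.
exists d, fullv; split=> //.
  move=> v; split=> [_ f _ hf|_]; last exact: memvf.
  exact: (diagonal_differential v n3 hx par hf).
rewrite dimvf /dim /=; lia.
Qed.

End Tangent.

End ResectioningVariety.

Theorem theorem6p6 (R : realType) (n : nat) (X : 'M[complex R]_(2, n)) :
  (4 <= n)%N -> multiproj X -> general_position X ->
  singular_locus (resectioning_variety 1 X) = rank_locus 1 n 1.
Proof.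
move=> n4 hX gp.
apply: resectioning_singular_locus => //.
exact: general_position_minor2.
Qed.
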